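(* Let $\mathbf J_1=(T_1,S_1)$ and $\mathbf J_2=(T_2,S_2)$ be frames, $t\colon\mathbf J_1\to\mathbf J_2$ a homomorphism of frames and $\mathbf H=(\mathbf G,F)$ an $F$-sup-semilattice. Then there exists a unique morphism of sup-semilattices $t\otimes\mathbf H\colon \mathbf J_1\otimes\mathbf H\to\mathbf J_2\otimes\mathbf H$ such that $$(t\otimes\mathbf H)\circ \mathrm n(j[\mathbf J_1,\mathbf H])=\mathrm n(j[\mathbf J_2,\mathbf H])\circ t^{\rightarrow},$$ where $t^{\rightarrow}\colon\mathbf G^{T_1}\to\mathbf G^{T_2}$ is given by $(t^{\rightarrow}(x))(k)=\bigvee\{x(i)\mid i\in T_1,\ t(i)=k\}$. Moreover, $-\otimes\mathbf H$ (sending $\mathbf J$ to $\mathbf J\otimes\mathbf H$ and $t$ to $t\otimes\mathbf H$) is a functor from the category of frames and frame homomorphisms to the category of sup-semilattices.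
   Context: A sup-semilattice is a poset in which every subset has a join (bottom element $0$); morphisms of sup-semilattices are maps preserving arbitrary joins. An $F$-sup-semilattice is a pair $(\mathbf G,F)$ where $\mathbf G$ is a sup-semilattice and $F\colon G\to G$ preserves arbitrary joins. A frame $\mathbf J=(T,S)$ is a set $T$ with a binary relation $S\subseteq T^2$; a homomorphism of frames $(T_1,S_1)\to(T_2,S_2)$ is a map $t\colon T_1\to T_2$ such that $(i,j)\in S_1$ implies $(t(i),t(j))\in S_2$. Construction of $\mathbf J\otimes\mathbf H$ for a frame $\mathbf J=(T,S)$ and an $F$-sup-semilattice $\mathbf H=(\mathbf G,F)$. Let $\mathbf G^T$ be the set of maps $T\to G$ with pointwise order. For $x\in G$, $i\in T$ let $x_{iS}\in G^T$ be given by $x_{iS}(k)=x$ if $(i,k)\in S$ and $x_{iS}(k)=0$ otherwise; let $x_{i=}\in G^T$ be given by $x_{i=}(i)=x$ and $x_{i=}(k)=0$ for $k\neq i$. Put $[\mathbf J,\mathbf H]=\{(x_{iS}\vee F(x)_{i=},\,F(x)_{i=})\mid x\in G,\ i\in T\}\subseteq (G^T)^2$. Define $j=j[\mathbf J,\mathbf H]\colon G^T\to G^T$ by $$j(a)=a\vee\bigvee\{c\in G^T\mid \text{there is } d\leq a \text{ with } (c,d)\in[\mathbf J,\mathbf H]\text{ or }(d,c)\in[\mathbf J,\mathbf H]\}.$$ Then $\mathbf J\otimes\mathbf H$ is the set $\{a\in G^T\mid j(a)=a\}$ of fixed points of $j$ with the order inherited from $\mathbf G^T$; and $\mathrm n(j)\colon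 G^T\to\mathbf J\otimes\mathbf H$ is the associated closure operator $\mathrm n(j)(a)=\bigwedge\{x\in G^T\mid j(x)=x,\ a\leq x\}$. $\mathbf J\otimes\mathbf H$ is a sup-semilattice whose join of a subset $M$ is $\mathrm n(j)(\bigvee M)$ with $\bigvee M$ computed in $\mathbf G^T$. *)

(* Defs.v *)
From HB Require Import structures.
From mathcomp Require Import all_boot all_order.
From mathcomp Require Import boolp classical_sets.

Set Implicit Arguments.
Unset Strict Implicit.
Unset Printing Implicit Defensive.

Import Order.TTheory.
Local Open Scope classical_set_scope.
Local Open Scope order_scope.

HB.mixin Record POrder_isSupSemilattice d T of Order.POrder d T := {
  ssup : set T -> T;
  ssupP : forall A : set T, supremums A (ssup A)
}.

#[short(type="supSemilatticeType")]
HB.structure Definition SupSemilattice d :=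
  {T of POrder_isSupSemilattice d T & Order.POrder d T}.

Definition sbot d (G : supSemilatticeType d) : G := ssup (set0 : set G).

Definition sjoin d (G : supSemilatticeType d) (x y : G) : G := ssup [set x; y].

Definition sinf d (G : supSemilatticeType d) (A : set G) : G := ssup (lbound A).

Section SupTheory.
Context d (G : supSemilatticeType d).
Implicit Types (A : set G) (x y z : G).

Lemma ssup_ub A x : A x -> x <= ssup A.
Proof. by have [ub _] := ssupP A; apply: ub. Qed.

Lemma ssup_le A z : (forall x, A x -> x <= z) -> ssup A <= z.
Proof. by have [_ lub] := ssupP A; apply: lub. Qed.

Lemma ssup_eq A z : supremums A z -> ssup A = z.
Proof. by move=> zA; apply: (@is_subset1_supremums _ _ A) => //; apply: ssupP. Qed.

Lemma sbot_le x : sbot G <= x.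
Proof. exact: ssup_le. Qed.

Lemma sjoinl x y : x <= sjoin x y.
Proof. by apply: ssup_ub; left. Qed.

Lemma sjoinr x y : y <= sjoin x y.
Proof. by apply: ssup_ub; right. Qed.

Lemma sjoin_le x y z : x <= z -> y <= z -> sjoin x y <= z.
Proof. by move=> xz yz; apply: ssup_le => _ [->|->]. Qed.

Lemma sinf_lb A x : A x -> sinf A <= x.
Proof. by move=> Ax; apply: ssup_le => y; apply. Qed.

Lemma sinf_ge A z : (forall x, A x -> z <= x) -> z <= sinf A.
Proof. by move=> zA; apply: ssup_ub. Qed.

End SupTheory.

(* The order on [T -> G] is the pointwise one provided by [boolp]. *)

Definition fun_ssup (T : Type) d (G : supSemilatticeType d)
    (A : set (T -> G)) : T -> G :=
  fun k => ssup [set a k | a in A].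

Lemma fun_ssupP (T : Type) d (G : supSemilatticeType d) (A : set (T -> G)) :
  supremums A (fun_ssup A).
Proof.
split=> [a Aa|b ub]; apply/lefP => k; first by apply: ssup_ub; exists a.
by apply: ssup_le => _ [a /ub /lefP /(_ k) ab <-].
Qed.

HB.instance Definition _ (T : Type) d (G : supSemilatticeType d) :=
  POrder_isSupSemilattice.Build FunOrder.fun_display (T -> G) (@fun_ssupP T d G).

Record supHom d1 d2 (A : supSemilatticeType d1) (B : supSemilatticeType d2) :=
  SupHom {
    supHom_fun :> A -> B;
    supHomP : forall M : set A, supHom_fun (ssup M) = ssup (supHom_fun @` M)
  }.

Record fSupSemilattice d := FSupSemilattice {
  fsup_sort :> supSemilatticeType d;
  fsup_op : supHom fsup_sort fsup_sort
}.

Record frame := Frame {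
  frame_sort :> Type;
  frame_rel : frame_sort -> frame_sort -> Prop
}.

Record frameHom (J1 J2 : frame) := FrameHom {
  frameHom_fun :> J1 -> J2;
  frameHomP : forall i j : J1,
    frame_rel i j -> frame_rel (frameHom_fun i) (frameHom_fun j)
}.

Section Tensor.
Context d (J : frame) (H : fSupSemilattice d).

(* x_{iS} and x_{i=} *)
Definition succ_vec (x : H) (i : J) : J -> H :=
  fun k => if `[< frame_rel i k >] then x else sbot H.

Definition point_vec (x : H) (i : J) : J -> H :=
  fun k => if `[< k = i >] then x else sbot H.

(* [J, H] *)
Definition tensor_rel : set ((J -> H) * (J -> H)) :=
  [set p | exists (x : H) (i : J),
     p = (sjoin (succ_vec x i) (point_vec (fsup_op H x) i),
          point_vec (fsup_op H x) i)].

(* j[J, H] *)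
Definition tensor_pre (a : J -> H) : J -> H :=
  sjoin a (ssup [set c | exists e : J -> H,
    e <= a /\ (tensor_rel (c, e) \/ tensor_rel (e, c))]).

Definition tensor := {a : J -> H | `[< tensor_pre a = a >]}.

(* The display is only a notational tag; reusing that of [H] puts [tensor J H],
   for all [J], in a single category [supCat d]. *)
HB.instance Definition _ := SubChoice.on tensor.
HB.instance Definition _ := [SubChoice_isSubPOrder of tensor by <: with d].

Lemma tensor_leE (m1 m2 : tensor) : (m1 <= m2) = (val m1 <= val m2).
Proof. by []. Qed.

Lemma tensor_pre_ge a : a <= tensor_pre a.
Proof. exact: sjoinl. Qed.

Lemma tensor_pre_mono a b : a <= b -> tensor_pre a <= tensor_pre b.
Proof.
move=> ab; apply: sjoin_le; first exact: le_trans ab (tensor_pre_ge b).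
apply: le_trans (sjoinr _ _); apply: ssup_le => c [e [ea ce]].
by apply: ssup_ub; exists e; split=> //; apply: le_trans ab.
Qed.

Definition tensor_closure_fun (a : J -> H) : J -> H :=
  sinf [set x | tensor_pre x = x /\ a <= x].

Lemma tensor_closure_subproof (a : J -> H) :
  `[< tensor_pre (tensor_closure_fun a) = tensor_closure_fun a >].
Proof.
apply/asboolP/le_anti; rewrite tensor_pre_ge andbT.
apply: sinf_ge => x [jx ax]; rewrite -[leRHS]jx.
by apply: tensor_pre_mono; apply: sinf_lb.
Qed.

(* n(j[J, H]) *)
Definition tensor_closure (a : J -> H) : tensor :=
  exist _ (tensor_closure_fun a) (tensor_closure_subproof a).

Definition tensor_ssup (M : set tensor) : tensor :=
  tensor_closure (ssup [set val m | m in M]).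

Lemma tensor_ssupP (M : set tensor) : supremums M (tensor_ssup M).
Proof.
split=> [m Mm|b ub]; rewrite tensor_leE /=.
  by apply: sinf_ge => x [_]; apply: le_trans; apply: ssup_ub; exists m.
apply: sinf_lb; split; first exact: asboolW (valP b).
by apply: ssup_le => _ [m /ub mb <-]; rewrite -tensor_leE.
Qed.

HB.instance Definition _ :=
  POrder_isSupSemilattice.Build d tensor tensor_ssupP.

End Tensor.

(* t^-> *)
Definition forward d (G : supSemilatticeType d) (T1 T2 : Type) (t : T1 -> T2)
    (x : T1 -> G) : T2 -> G :=
  fun k => ssup [set x i | i in t @^-1` [set k]].

Record category := Category {
  cat_obj :> Type;
  cat_hom : cat_obj -> cat_obj -> Type;
  cat_id : forall A : cat_obj, cat_hom A A;
  cat_comp : forall A B C : cat_obj, cat_hom B C -> cat_hom A B -> cat_hom A C;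
  cat_compA : forall (A B C D : cat_obj) (h : cat_hom C D) (g : cat_hom B C) (f : cat_hom A B),
    cat_comp h (cat_comp g f) = cat_comp (cat_comp h g) f;
  cat_idl : forall (A B : cat_obj) (f : cat_hom A B), cat_comp (cat_id B) f = f;
  cat_idr : forall (A B : cat_obj) (f : cat_hom A B), cat_comp f (cat_id A) = f
}.

Definition is_functor (C D : category) (Fo : C -> D)
    (Fm : forall A B : C, cat_hom A B -> cat_hom (Fo A) (Fo B)) : Prop :=
  (forall A : C, Fm A A (cat_id A) = cat_id (Fo A)) /\
  (forall (A B E : C) (g : cat_hom B E) (f : cat_hom A B),
     Fm A E (cat_comp g f) = cat_comp (Fm B E g) (Fm A B f)).

Section FrameCategory.

Lemma frameHom_eq (J1 J2 : frame) (f g : frameHom J1 J2) :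
  f =1 g -> f = g.
Proof.
case: f g => [f fP] [g gP] /= /funext fg; case: _ / fg in gP *.
by congr FrameHom; apply: Prop_irrelevance.
Qed.

Definition frame_id (J : frame) : frameHom J J :=
  @FrameHom J J id (fun _ _ ij => ij).

Definition frame_comp (J1 J2 J3 : frame) (g : frameHom J2 J3)
    (f : frameHom J1 J2) : frameHom J1 J3 :=
  @FrameHom J1 J3 (g \o f) (fun _ _ ij => frameHomP g (frameHomP f ij)).

Definition frameCat : category.
Proof.
refine (@Category frame frameHom frame_id frame_comp _ _ _);
  by move=> *; apply: frameHom_eq.
Defined.

End FrameCategory.

Section SupCategory.
Context (d : Order.disp_t).

Lemma supHom_eq (A B : supSemilatticeType d) (f g : supHom A B) :
  f =1 g -> f = g.
Proof.
case: f g => [f fP] [g gP] /= /funext fg; case: _ / fg in gP *.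
by congr SupHom; apply: Prop_irrelevance.
Qed.

Lemma sup_idP (A : supSemilatticeType d) (M : set A) :
  id (ssup M) = ssup (id @` M).
Proof. by rewrite image_id. Qed.

Definition sup_id (A : supSemilatticeType d) : supHom A A := SupHom (@sup_idP A).

Lemma sup_compP (A B C : supSemilatticeType d) (g : supHom B C)
    (f : supHom A B) (M : set A) : (g \o f) (ssup M) = ssup ((g \o f) @` M).
Proof. by rewrite /= !supHomP image_comp. Qed.

Definition sup_comp (A B C : supSemilatticeType d) (g : supHom B C)
    (f : supHom A B) : supHom A C := SupHom (sup_compP g f).

Definition supCat : category.
Proof.
refine (@Category (supSemilatticeType d) (fun A B => supHom A B)
          sup_id sup_comp _ _ _);
  by move=> *; apply: supHom_eq.
Defined.

End SupCategory.

(* Main.v *)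
Require Import Defs.
From mathcomp Require Import all_boot all_order.
From mathcomp Require Import boolp classical_sets.

(**
A vector [a] is a fixed point of [j[J, H]] iff [F x <= a i] and [i S k] imply
[x <= a k]. This condition is inherited by [b \o t] from [b], so composition
with [t] maps [J2 (x) H] to [J1 (x) H]. The map [t (x) H] is its left adjoint,
hence preserves joins; the defining equation and functoriality compare left
adjoints of equal maps. Uniqueness holds because the closure operator is
surjective onto [J (x) H].
*)

Set Implicit Arguments.
Unset Strict Implicit.
Unset Printing Implicit Defensive.

Import Order.TTheory.
Local Open Scope classical_set_scope.
Local Open Scope order_scope.

(** Yoneda for posets: [z := y] and [z := x] give the two inequalities. Left adjoints can thus be
    compared through their right adjoints. *)
Lemma eq_from_upper_bounds d (P : porderType d) (x y : P) :
  (forall z, x <= z <-> y <= z) -> x = y.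
Proof. by move=> xy; apply/le_anti/andP; split; apply/xy. Qed.

Lemma left_adjoint_ssup d1 d2 (A : supSemilatticeType d1)
    (B : supSemilatticeType d2) (f : A -> B) (g : B -> A) :
  (forall a b, f a <= b <-> a <= g b) ->
  forall M : set A, f (ssup M) = ssup (f @` M).
Proof.
move=> fg M; apply/esym/ssup_eq; split=> [_ [m Mm <-]|b ub].
  by apply/fg; apply: le_trans (ssup_ub Mm) _; apply/fg.
by apply/fg/ssup_le => m Mm; apply/fg/ub; exists m.
Qed.

(** A join over the fibre of [k] is bounded by [y k] iff each of its members is; so [forward t] is
    the left Kan extension along [t]. *)
Lemma forward_le d (G : supSemilatticeType d) (T1 T2 : Type) (t : T1 -> T2)
    (x : T1 -> G) (y : T2 -> G) :
  forward t x <= y <-> x <= y \o t.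
Proof.
split=> /lefP xy; apply/lefP => k.
  by apply: le_trans (xy (t k)); apply: ssup_ub; exists k.
by apply: ssup_le => _ [i <- <-]; apply: xy.
Qed.

Section TensorFixedPoints.
Context d (J : frame) (H : fSupSemilattice d).
Implicit Types (a b : J -> H) (m : tensor J H).

Lemma point_vec_le (x : H) (i : J) a : point_vec x i <= a <-> x <= a i.
Proof.
rewrite /point_vec; split=> [/lefP /(_ i)|xa]; first by rewrite asboolT.
by apply/lefP => k; case: asboolP => [->|_] //; apply: sbot_le.
Qed.

Lemma succ_vec_le (x : H) (i : J) a :
  succ_vec x i <= a <-> forall k, frame_rel i k -> x <= a k.
Proof.
rewrite /succ_vec; split=> [/lefP xa k ik|xa].
  by have := xa k; rewrite asboolT.
by apply/lefP => k; case: asboolP => [/xa|_] //; apply: sbot_le.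
Qed.

(** A generating pair has its second entry below [a] exactly when [F x <= a i], and its first entry
    then contributes [succ_vec x i]. Reversed pairs contribute nothing new, the second entry being
    below the first. *)
Lemma tensor_fixedP a :
  tensor_pre a = a <->
  forall (x : H) (i k : J), frame_rel i k -> fsup_op H x <= a i -> x <= a k.
Proof.
split=> [fix_a x i k ik Fxa|closed_a].
  have /succ_vec_le : succ_vec x i <= a; last exact.
  rewrite -[leRHS]fix_a.
  (* Enlarge [succ_vec x i] to the first entry of its generating pair, a member of the join in
     [tensor_pre a]. *)
  apply: le_trans (sjoinl _ (point_vec (fsup_op H x) i)) _.
  apply: le_trans (sjoinr _ _); apply: ssup_ub.
  exists (point_vec (fsup_op H x) i); split; first exact/point_vec_le.
  by left; exists x, i.
apply/le_anti; rewrite tensor_pre_ge andbT; apply: sjoin_le => //.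
apply: ssup_le => c [e [ea [|]]] [x [i [ce ec]]]; subst c e.
  apply: sjoin_le => //; apply/succ_vec_le => k ik.
  by apply: closed_a ik _; apply/point_vec_le.
exact: le_trans (sjoinr _ _) ea.
Qed.

Lemma tensor_val_fixed m : tensor_pre (val m) = val m.
Proof. exact: asboolW (valP m). Qed.

Lemma tensor_closure_le a m : tensor_closure a <= m <-> a <= val m.
Proof.
rewrite tensor_leE /=; split=> [|am].
  by apply: le_trans; apply: sinf_ge => x [].
by apply: sinf_lb; split=> //; apply: tensor_val_fixed.
Qed.

Lemma tensor_closure_val m : tensor_closure (val m) = m.
Proof. by apply: eq_from_upper_bounds => n; apply: tensor_closure_le. Qed.

End TensorFixedPoints.

Section TensorMap.
Context d (H : fSupSemilattice d) (J1 J2 : frame) (t : frameHom J1 J2).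

(** The homomorphism [t] carries [i S1 k] to [t i S2 t k], where the closure condition on [val m]
    applies. *)
Lemma tensor_pullback_subproof (m : tensor J2 H) :
  `[< tensor_pre (val m \o t : J1 -> H) = val m \o t >].
Proof.
apply/asboolP/tensor_fixedP => x i k /(frameHomP t) ik.
by have /tensor_fixedP := tensor_val_fixed m; apply.
Qed.

Definition tensor_pullback (m : tensor J2 H) : tensor J1 H :=
  exist _ (val m \o t) (tensor_pullback_subproof m).

(** The formula is forced: it is the defining equation evaluated at [val m], whose closure is
    [m]. *)
Definition tensor_map_fun (m : tensor J1 H) : tensor J2 H :=
  tensor_closure (forward t (val m)).

Lemma tensor_map_adjoint (m : tensor J1 H) (n : tensor J2 H) :
  tensor_map_fun m <= n <-> m <= tensor_pullback n.
Proof. exact: iff_trans (tensor_closure_le _ _) (forward_le _ _ _). Qed.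

Definition tensor_map : supHom (tensor J1 H) (tensor J2 H) :=
  SupHom (left_adjoint_ssup tensor_map_adjoint).

Lemma tensor_map_closure :
  tensor_map \o @tensor_closure d J1 H = @tensor_closure d J2 H \o forward t.
Proof.
apply/funext => a; apply: eq_from_upper_bounds => n.
(* Both sides lie below [n] iff [a <= val n \o t]. *)
apply: (iff_trans (tensor_map_adjoint _ _)).
apply: (iff_trans (tensor_closure_le _ _)).
by apply: iff_sym; apply: (iff_trans (tensor_closure_le _ _)); apply: forward_le.
Qed.

Lemma tensor_map_unique (f : supHom (tensor J1 H) (tensor J2 H)) :
  f \o @tensor_closure d J1 H = @tensor_closure d J2 H \o forward t ->
  tensor_map = f.
Proof.
move=> fE; apply: supHom_eq => m.
by rewrite -{2}(tensor_closure_val m) -[RHS]/((f \o _) _) fE.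
Qed.

End TensorMap.

Lemma tensor_map_id d (H : fSupSemilattice d) (J : frame) :
  tensor_map H (frame_id J) = sup_id (tensor J H).
Proof.
apply: supHom_eq => m; apply: eq_from_upper_bounds => n.
(* Pulling back along the identity leaves the underlying vector unchanged up to conversion. *)
exact: tensor_map_adjoint.
Qed.

Lemma tensor_map_comp d (H : fSupSemilattice d) (J1 J2 J3 : frame)
    (g : frameHom J2 J3) (f : frameHom J1 J2) :
  tensor_map H (frame_comp g f) = sup_comp (tensor_map H g) (tensor_map H f).
Proof.
apply: supHom_eq => m; apply: eq_from_upper_bounds => n.
apply: (iff_trans (tensor_map_adjoint _ _ _)); apply: iff_sym.
apply: (iff_trans (tensor_map_adjoint _ _ _)).
(* Pulling back along [g], then [f], is by conversion composition with [g \o f]. *)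
exact: tensor_map_adjoint.
Qed.

Theorem theorem3p6 (d : Order.disp_t) (H : fSupSemilattice d) :
  (forall (J1 J2 : frame) (t : frameHom J1 J2),
     exists! f : supHom (tensor J1 H) (tensor J2 H),
       f \o @tensor_closure d J1 H = @tensor_closure d J2 H \o forward t) /\
  (exists tensor_map : forall J1 J2 : frame,
     frameHom J1 J2 -> supHom (tensor J1 H) (tensor J2 H),
     (forall (J1 J2 : frame) (t : frameHom J1 J2),
        tensor_map J1 J2 t \o @tensor_closure d J1 H
        = @tensor_closure d J2 H \o forward t) /\
     is_functor (C := frameCat) (D := supCat d)
       (Fo := fun J : frame => (tensor J H : supSemilatticeType d)) tensor_map).
Proof.
split=> [J1 J2 t|].
  exists (tensor_map H t); split; first exact: tensor_map_closure.
  exact: tensor_map_unique.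
exists (@tensor_map d H); split; first exact: tensor_map_closure.
split=> [J|J1 J2 J3 g f]; first exact: tensor_map_id.
exact: tensor_map_comp.
Qed.
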